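(* Let $p\in(0,1)$, let $I$ be a Bernoulli random variable with $\mathbb{P}(I=1)=1-p$ and $\mathbb{P}(I=0)=p$, and let $X$ be a real-valued random variable. A real-valued random variable $W$ satisfies $$W\sim I\,(W+X)^+,$$ where $X,I,W$ on the right-hand side are assumed independent, if and only if $$W\sim \bar S_N\equiv\max_{k\in\{0,\ldots,N\}}S_k,$$ where $S\equiv(S_k)_{k\in\mathbb{N}}$ is a random walk with $S_0=0$ and i.i.d. increments distributed like $X$, $N$ is independent of $S$, and $N+1$ is geometrically distributed with parameter $p$, i.e. $\mathbb{P}(N=n)=(1-p)^np$ for $n=0,1,2,\ldots$.
   Context: The symbol $\sim$ denotes equality in distribution, $x^+=\max(x,0)$, and $\mathbb{N}=\{0,1,2,\ldots\}$. ''$W\sim I(W+X)^+$ with $X,I,W$ on the right independent'' means: if $X',I',W'$ are independent with the same laws as $X,I,W$, respectively, then $I'(W'+X')^+$ has the same law as $W$. *)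

(* Defs.v *)
From HB Require Import structures.
From mathcomp Require Import all_boot all_order all_algebra.
From mathcomp Require Import finmap.
From mathcomp Require Import all_classical all_reals all_analysis.
From mathcomp Require Import measurable_realfun.

Set Implicit Arguments.
Unset Strict Implicit.
Unset Printing Implicit Defensive.

Import Order.TTheory GRing.Theory Num.Theory.

Local Open Scope classical_set_scope.
Local Open Scope ring_scope.

(* Equality in distribution. The quantifier ranges over measurable sets only:
   [distribution P X] is a total function on [set T'] whose values on
   nonmeasurable sets carry no meaning. *)
Definition eq_law d1 d2 d' (T1 : measurableType d1) (T2 : measurableType d2)
    (T' : measurableType d') (R : realType)
    (P1 : probability T1 R) (P2 : probability T2 R)
    (X1 : {RV P1 >-> T'}) (X2 : {RV P2 >-> T'}) : Prop :=
  forall A : set T', measurable A ->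
    distribution P1 X1 A = distribution P2 X2 A.

Section random_walk.
Context d (T : measurableType d) (R : realType) (P : probability T R).

Definition mutually_independent (K : choiceType) d' (T' : measurableType d')
    (X : K -> {RV P >-> T'}) : Prop :=
  forall (J : {fset K}) (A : K -> set T'),
    (forall k, k \in J -> measurable (A k)) ->
    P (\bigcap_(k in [set` J]) (X k @^-1` A k)) =
    (\prod_(k <- J) P (X k @^-1` A k))%E.

Definition sigma_process d' (T' : measurableType d')
    (S : nat -> {RV P >-> T'}) : set (set T) :=
  <<s \bigcup_k g_sigma_algebra_preimage (S k) >>.

Definition independent_of_process d1 d2 (T1 : measurableType d1)
    (T2 : measurableType d2) (N : {RV P >-> T1}) (S : nat -> {RV P >-> T2}) :
    Prop :=
  forall A B : set T, g_sigma_algebra_preimage N A -> sigma_process S B ->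
    P (A `&` B) = (P A * P B)%E.

Definition increment (S : nat -> {RV P >-> R}) (k : nat) : {RV P >-> R} :=
  S k.+1 \- S k.

Definition random_walk (S : nat -> {RV P >-> R})
    dX (TX : measurableType dX) (PX : probability TX R)
    (X : {RV PX >-> R}) : Prop :=
  [/\ forall w, S 0%N w = 0,
      mutually_independent (increment S) &
      forall k, eq_law (increment S k) X].

(* The default value [S 0] of the iterated maximum is itself in the range, so
   this is the maximum of S_0, ..., S_N. *)
Definition stopped_max (S : nat -> {RV P >-> R}) (N : {RV P >-> nat})
    (w : T) : R :=
  \big[Num.max/S 0%N w]_(0 <= k < (N w).+1) S k w.

Lemma measurable_stopped_max S N : measurable_fun setT (stopped_max S N).
Proof.
pose M (s : seq nat) w : R := \big[Num.max/S 0%N w]_(k <- s) S k w.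
have mM s : measurable_fun setT (M s).
  elim: s => [|k s IH].
    rewrite (_ : M [::] = S 0%N); first exact: measurable_funPT.
    by apply/funext => w; rewrite /M big_nil.
  rewrite (_ : M (k :: s) = S k \max M s).
    by apply: measurable_maxr => //; exact: measurable_funPT.
  by apply/funext => w; rewrite /M big_cons.
move=> _ A mA; rewrite setTI.
rewrite (_ : _ @^-1` _ = \bigcup_n (N @^-1` [set n] `&`
    M (index_iota 0 n.+1) @^-1` A)); last first.
  apply/seteqP; split=> [w Aw|w [n _ [/= <-]]//].
  by exists (N w).
apply: bigcup_measurable => n _; apply: measurableI.
  by rewrite -[X in measurable X]setTI; exact: measurable_funPT.
by rewrite -[X in measurable X]setTI; exact: mM.
Qed.

HB.instance Definition _ S N := isMeasurableFun.Build _ _ _ _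
  (stopped_max S N) (measurable_stopped_max S N).

End random_walk.

(* [W] ~ [I (W + X)^+] with independent [X], [I], [W] on the right. The three
   given variables may live on different probability spaces: only their laws
   matter, through independent copies on a common space. *)
Definition solves_fixpoint (R : realType) dX dI dW (TX : measurableType dX)
    (TI : measurableType dI) (TW : measurableType dW) (PX : probability TX R)
    (PI : probability TI R) (PW : probability TW R) (X : {RV PX >-> R})
    (I : {RV PI >-> R}) (W : {RV PW >-> R}) : Prop :=
  forall d (T : measurableType d) (P : probability T R)
    (X' I' W' : {RV P >-> R}),
    mutually_independent (tnth [tuple X'; I'; W']) ->
    eq_law X' X -> eq_law I' I -> eq_law W' W ->
    eq_law (I' \* (W' \+ X')^\+ : {RV P >-> R}) W.

(* Main.v *)
From HB Require Import structures.
Require Import Defs.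
From mathcomp Require Import all_boot all_order all_algebra.
From mathcomp Require Import finmap.
From mathcomp Require Import all_classical all_reals all_analysis.
From mathcomp Require Import measurable_realfun.

Import Order.TTheory GRing.Theory Num.Theory.

Local Open Scope classical_set_scope.
Local Open Scope ring_scope.

(** Write [nu] for the law of X, [mu] for the law of W, and let
    [lindley (x, w) = (w + x)^+]. Conditioning on I turns the fixed-point
    equation into an equation between laws: [mu] is a fixed point of
      [mu |-> p * delta_0 + (1 - p) * (nu \x mu) (lindley @^-1` _)],
    which is [lindley_update p nu]. Since independent copies of X, I and W exist
    on a product space, this reformulation loses nothing
    ([solves_fixpointP]).

    The update contracts the total variation distance by the factor [1 - p],
    because integrating sections against the probability [nu] cannot increase
    the largest gap between two laws. Hence there is at most one fixed point
    ([update_fixpoint_unique]), and it remains to see that the law of the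
    maximum stopped at N is one ([stopped_max_fixpoint]).

    For this, let [L n] be the law of max(S_0, ..., S_n). Singling out the first
    increment, max(S_0, ..., S_(n+1)) is the positive part of a sum: that
    increment plus the maximum over n steps of the walk restarted at time 1,
    which is independent of the first increment and has law [L n]. So
    [L n.+1 = (nu \x L n) (lindley @^-1` _)] ([reflected_max_law]). As N is
    independent of S, the law of the stopped maximum is the mixture of the [L n]
    with the geometric weights [(1 - p)^n p]; its term of index 0 is
    [p * delta_0], and the recursion turns the remaining terms into [1 - p]
    times the image of the mixture itself. *)

(** * Independence and product laws *)

(** Both sides are finite measures in [D] that agree on the rectangles, a
    pi-system generating the product sigma-algebra. Keeping the event [E] in the
    statement makes it possible to carry the independence from a third source
    of randomness along without generating its sigma-algebra. *)
Lemma joint_law_given {d d1 d2} {T : measurableType d} {T1 : measurableType d1}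
    {T2 : measurableType d2} {R : realType} (P : probability T R)
    (m1 : probability T1 R) (m2 : probability T2 R)
    (X : {RV P >-> T1}) (Y : {RV P >-> T2}) (E : set T) :
  measurable E ->
  (forall A B, measurable A -> measurable B ->
    P (E `&` (X @^-1` A `&` Y @^-1` B)) = (P E * (m1 A * m2 B))%E) ->
  forall D, measurable D ->
    P (E `&` [set w | D (X w, Y w)]) = (P E * (m1 \x m2)%E D)%E.
Proof.
move=> mE rect D mD.
have mXY : measurable_fun setT (fun w => (X w, Y w)).
  by apply: measurable_fun_pair; exact: measurable_funPT.
pose XY : {mfun T >-> (T1 * T2)%type} :=
  HB.pack (fun w => (X w, Y w)) (isMeasurableFun.Build _ _ _ _ _ mXY).
have PE0 : (0 <= fine (P E))%R by exact: fine_ge0.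
have PEfin : P E \is a fin_num by exact: fin_num_measure.
pose c := NngNum PE0.
pose C := [set A `*` B | A in @measurable _ T1 & B in @measurable _ T2].
have PXYE D' : P (E `&` [set w | D' (X w, Y w)]) =
    pushforward (mrestr P mE) XY D'.
  by rewrite /pushforward /mrestr setIC.
have cE D' : (P E * (m1 \x m2) D')%E = mscale c (m1 \x m2)%E D'.
  by rewrite /mscale/= fineK.
rewrite PXYE cE.
apply: (measure_unique C (fun=> setT)) => //.
- exact: measurable_prod_measurableType.
- move=> _ _ [A mA [B mB <-]] [A' mA' [B' mB' <-]].
  exists (A `&` A'); first exact: measurableI.
  by exists (B `&` B'); [exact: measurableI|rewrite setXI].
- by move=> _; exists setT => //; exists setT => //; rewrite setXTT.
- by rewrite bigcup_const.
- move=> _ [A mA [B mB <-]].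
  transitivity (P (E `&` (X @^-1` A `&` Y @^-1` B))); first exact/esym/PXYE.
  by rewrite rect// -product_measure1E//; exact: cE.
- move=> _; rewrite [ltLHS](_ : _ = P E) ?ltey_eq ?PEfin//.
  by rewrite -[in RHS](setIT E); exact/esym/PXYE.
Qed.

(** A product rule over a subfamily is the rule for the full family with the
    whole space put in the missing coordinates. *)
Lemma mutually_independent3P {d d'} {T : measurableType d}
    {T' : measurableType d'} {R : realType} (P : probability T R)
    (X Y Z : {RV P >-> T'}) :
  mutually_independent (tnth [tuple X; Y; Z]) <->
  forall A B C, measurable A -> measurable B -> measurable C ->
    P (X @^-1` A `&` Y @^-1` B `&` Z @^-1` C) =
    (P (X @^-1` A) * P (Y @^-1` B) * P (Z @^-1` C))%E.
Proof.
split=> [ind A B C mA mB mC|prod3 J A mA].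
  pose F (k : 'I_3) := tnth [tuple A; B; C] k.
  have mF k : measurable (F k) by case: k => -[|[|[|]]].
  have := ind [fset k | k in 'I_3]%fset F (fun k _ => mF k).
  rewrite big_uniq ?fset_uniq//=.
  rewrite (eq_bigl predT); last by move=> k; rewrite !inE.
  rewrite !big_ord_recl big_ord0 mule1 muleA => <-; congr (P _).
  apply/seteqP; split=> [w [[Aw Bw] Cw] k _|w /= F3]; first by case: k => -[|[|[|]]].
  split; [split|].
  - by have := F3 ord0; rewrite /= !inE => /(_ isT).
  - by have := F3 (lift ord0 ord0); rewrite /= !inE => /(_ isT).
  - by have := F3 (lift ord0 (lift ord0 ord0)); rewrite /= !inE => /(_ isT).
pose F k := if k \in J then A k else setT.
have mF k : measurable (F k) by rewrite /F; case: ifPn => // /mA.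
transitivity (\prod_(k : 'I_3) P (tnth [tuple X; Y; Z] k @^-1` F k))%E.
  rewrite !big_ord_recl big_ord0 mule1 muleA -prod3//; congr (P _).
  apply/seteqP; split=> [w Aw|w [[F0 F1] F2] k kJ].
    by split; [split|]; rewrite /F/=; case: ifPn => // kJ; exact: Aw.
  suff: F k (tnth [tuple X; Y; Z] k w) by rewrite /F ifT.
  case: k kJ => -[|[|[|//]]] /= k3 _.
  - by move: F0; congr (F _ _); exact: val_inj.
  - by move: F1; congr (F _ _); exact: val_inj.
  - by move: F2; congr (F _ _); exact: val_inj.
rewrite [RHS]big_uniq ?fset_uniq//= [RHS]big_mkcond/=; apply: eq_bigr => k _.
by rewrite /F; case: ifPn => // _; rewrite preimage_setT probability_setT.
Qed.

(** * The fixed-point equation as an equation between laws *)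

(** The first coordinate is the increment and the second the current level: with
    the increment first, sections of the product measure are taken at a fixed
    increment, and the law of the level is what is evaluated on them. *)
Definition lindley {R : realType} (z : R * R) : R := Num.max (z.2 + z.1) 0.

Lemma measurable_lindley {R : realType} :
  measurable_fun setT (@lindley R).
Proof.
apply: measurable_maxr; last exact: measurable_cst.
by apply: measurable_funD; [exact: measurable_snd|exact: measurable_fst].
Qed.

Lemma measurable_lindley_preimage {R : realType} (A : set R) :
  measurable A -> measurable (@lindley R @^-1` A).
Proof.
by move=> mA; rewrite -[X in measurable X]setTI; exact: measurable_lindley.
Qed.

(** The law of I (W + X)^+ when W has law [mu] and X has law [nu], all three
    independent, computed by conditioning on I. *)
Definition lindley_update {R : realType} (p : R) (nu mu : set R -> \bar R)
    (A : set R) : \bar R :=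
  (p%:E * \d_(0%R : R) A + (1 - p)%:E * (nu \x mu) (lindley @^-1` A))%E.

Lemma measurable_RV {d d'} {T : measurableType d} {T' : measurableType d'}
    {R : realType} {P : probability T R} (X : {RV P >-> T'}) (A : set T') :
  measurable A -> measurable (X @^-1` A).
Proof.
by move=> mA; rewrite -[X in measurable X]setTI; exact: measurable_funPT.
Qed.

(** Up to a null event I is 0 or 1. On I = 0 the product vanishes; on I = 1 it
    is [lindley] of the pair (X, W), whose law given I = 1 is the product. *)
Lemma update_law {d} {T : measurableType d} {R : realType} (p : R)
    (P : probability T R) (X I W : {RV P >-> R})
    (nu mu : probability R R) :
  mutually_independent (tnth [tuple X; I; W]) ->
  P (I @^-1` [set 1]) = (1 - p)%:E -> P (I @^-1` [set 0]) = p%:E ->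
  (forall A, measurable A -> P (X @^-1` A) = nu A) ->
  (forall A, measurable A -> P (W @^-1` A) = mu A) ->
  forall A, measurable A ->
    P ((I \* (W \+ X)^\+) @^-1` A) = lindley_update p nu mu A.
Proof.
move=> /mutually_independent3P ind I1 I0 lawX lawW A mA.
pose E1 := I @^-1` [set 1]; pose E0 := I @^-1` [set 0].
rewrite -/E1 in I1; rewrite -/E0 in I0.
have mE1 : measurable E1 by exact: measurable_RV.
have mE0 : measurable E0 by exact: measurable_RV.
pose U := (I \* (W \+ X)^\+) @^-1` A.
have mU : measurable U.
  exact: (@measurable_RV _ _ _ _ _ P (I \* (W \+ X)^\+ : {RV P >-> R})).
(* The values of I outside {0, 1} are negligible since p + (1 - p) = 1. *)
pose Z := ~` (E1 `|` E0).
have mZ : measurable Z by apply: measurableC; exact: measurableU.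
have dis : E1 `&` E0 = set0.
  by rewrite -subset0 => w []; rewrite /E1 /E0/= => -> /eqP; rewrite oner_eq0.
have PZ : P Z = 0%E.
  rewrite /Z probability_setC; last exact: measurableU.
  rewrite measureU//=.
  by rewrite I1 I0 -EFinD subrK subrr.
have ZU0 : P (Z `&` U) = 0%E.
  apply: (@subset_measure0 _ _ _ P _ Z) => //; first exact: measurableI.
have PU : P U = (P (E1 `&` U) + P (E0 `&` U))%E.
  have UE : U = ((E1 `&` U) `|` (E0 `&` U)) `|` (Z `&` U).
    by rewrite -!setIUl /Z setUv setTI.
  rewrite [in LHS]UE.
  have mEU F : measurable F -> measurable (F `&` U).
    by move=> mF; exact: measurableI.
  have mE10U : measurable (E1 `&` U `|` E0 `&` U) by apply: measurableU; exact: mEU.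
  have disZ : (E1 `&` U `|` E0 `&` U) `&` (Z `&` U) = set0.
    by rewrite -(setIUl E1 E0 U) setIACA /Z setICr set0I.
  have dis10 : (E1 `&` U) `&` (E0 `&` U) = set0 by rewrite setIACA dis set0I.
  rewrite measureU//; last exact: mEU.
  by rewrite /= ZU0 adde0 measureU//; exact: mEU.
rewrite -/U PU addeC; congr (_ + _)%E.
  rewrite diracE; have [A0|A0] := pselect (A 0).
    rewrite mem_set// mule1 -I0; congr (P _); apply/seteqP; split=> [w []//|w E0w].
    by split => //; rewrite /U/= E0w mul0r.
  rewrite memNset// mule0 [X in P X](_ : _ = set0) ?measure0// -subset0 => w [E0w].
  by rewrite /U/= E0w mul0r.
rewrite -I1.
rewrite -(@joint_law_given _ _ _ _ _ _ _ _ _ _ X W)//.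
- congr (P _); apply/seteqP; split=> w [E1w];
    by rewrite /U/= /lindley/= E1w mul1r.
- move=> B C mB mC.
  by rewrite setICA setIA ind// lawX// lawW// -/E1 (muleC (nu B)) -muleA.
- exact: measurable_lindley_preimage.
Qed.

(** Bounding the gap section by section costs nothing because [nu] has total
    mass 1; this is the step behind the contraction. *)
Lemma le_product_measure {d1 d2} {T1 : measurableType d1}
    {T2 : measurableType d2} {R : realType} (nu : probability T1 R)
    (mu pi : probability T2 R) (c : R) : (0 <= c)%R ->
  (forall A, measurable A -> mu A <= pi A + c%:E)%E ->
  forall D, measurable D -> ((nu \x mu) D <= (nu \x pi) D + c%:E)%E.
Proof.
move=> c0 le_mu D mD.
have -> : c%:E = (\int[nu]_x cst c%:E x)%E.
  by rewrite integral_cst//= probability_setT mule1.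
rewrite -ge0_integralD//; last exact: measurable_fun_xsection.
apply: ge0_le_integral => //.
- exact: measurable_fun_xsection.
- by apply: emeasurable_funD => //; exact: measurable_fun_xsection.
- by move=> x _; apply: le_mu; exact: measurable_xsection.
Qed.

(** The two fixed points differ by at most 1 on every event, and each
    application of the update multiplies such a uniform bound by [1 - p]: the atoms
    [p * delta_0] cancel and [le_product_measure] handles the rest. *)
Lemma update_fixpoint_unique {R : realType} (p : R)
    (nu mu pi : probability R R) : 0 < p < 1 ->
  (forall A, measurable A -> mu A = lindley_update p nu mu A) ->
  (forall A, measurable A -> pi A = lindley_update p nu pi A) ->
  forall A, measurable A -> mu A = pi A.
Proof.
move=> /andP[p0 p1].
have q0 : 0 <= 1 - p by rewrite subr_ge0 ltW.
(* The hypotheses are symmetric in the two laws: one inequality suffices. *)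
wlog suff le_fix : mu pi /
  (forall A, measurable A -> mu A = lindley_update p nu mu A) ->
  (forall A, measurable A -> pi A = lindley_update p nu pi A) ->
  forall A, measurable A -> (mu A <= pi A)%E.
  by move=> fmu fpi A mA; apply/eqP; rewrite eq_le !le_fix.
move=> fmu fpi.
have le_n n A : measurable A -> (mu A <= pi A + ((1 - p) ^+ n)%:E)%E.
  elim: n A => [|n IH] A mA.
    by rewrite expr0 (le_trans (probability_le1 _ mA))// leeDr.
  rewrite fmu// fpi// /lindley_update -addeA leeD2l//.
  rewrite exprS EFinM -muleDr//; last first.
    by rewrite fin_num_adde_defl.
  rewrite lee_pmul2l// ?lte_fin ?subr_gt0//.
  apply: le_product_measure => //; first exact: exprn_ge0.
  exact: measurable_lindley_preimage.
move=> A mA.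
have := fin_num_measure mu A mA; have := fin_num_measure pi A mA.
move=> /fineK <- /fineK <-.
apply/lee_addgt0Pr => e e0.
have q1 : `|1 - p| < 1 by rewrite ger0_norm// ltrBlDr ltrDl.
have := cvg_expr q1 => /cvgrPdist_lt/(_ e e0)[n _ /(_ n (leqnn n))].
rewrite sub0r normrN ger0_norm ?exprn_ge0// => ltn.
rewrite -EFinD lee_fin (@le_trans _ _ (fine (pi A) + (1 - p) ^+ n))//; last first.
  by rewrite lerD2l ltW.
rewrite -lee_fin EFinD !fineK ?fin_num_measure//.
exact: le_n.
Qed.

(** The fixed-point property quantifies over independent copies, so it would
    hold vacuously if there were none: the coordinates of the product space
    provide them. *)
Lemma independent_triple {R : realType} {dX dI dW} {TX : measurableType dX}
    {TI : measurableType dI} {TW : measurableType dW} (PX : probability TX R)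
    (PI : probability TI R) (PW : probability TW R)
    (X : {RV PX >-> R}) (I : {RV PI >-> R}) (W : {RV PW >-> R}) :
  let P := ((PX \x PI) \x PW)%E : probability (TX * TI * TW)%type R in
  exists X' I' W' : {RV P >-> R},
    [/\ mutually_independent (tnth [tuple X'; I'; W']),
        eq_law X' X, eq_law I' I & eq_law W' W].
Proof.
move=> P.
have mX : measurable_fun setT (fun w : TX * TI * TW => X w.1.1).
  apply: measurableT_comp; first exact: measurable_funPT.
  by apply: measurableT_comp; exact: measurable_fst.
have mI : measurable_fun setT (fun w : TX * TI * TW => I w.1.2).
  apply: measurableT_comp; first exact: measurable_funPT.
  by apply: measurableT_comp; [exact: measurable_snd|exact: measurable_fst].
have mW : measurable_fun setT (fun w : TX * TI * TW => W w.2).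
  apply: measurableT_comp; first exact: measurable_funPT.
  exact: measurable_snd.
pose X' : {mfun (TX * TI * TW)%type >-> R} :=
  HB.pack (fun w : TX * TI * TW => X w.1.1) (isMeasurableFun.Build _ _ _ _ _ mX).
pose I' : {mfun (TX * TI * TW)%type >-> R} :=
  HB.pack (fun w : TX * TI * TW => I w.1.2) (isMeasurableFun.Build _ _ _ _ _ mI).
pose W' : {mfun (TX * TI * TW)%type >-> R} :=
  HB.pack (fun w : TX * TI * TW => W w.2) (isMeasurableFun.Build _ _ _ _ _ mW).
have box A B C : measurable A -> measurable B -> measurable C ->
    P (X' @^-1` A `&` I' @^-1` B `&` W' @^-1` C) =
    (PX (X @^-1` A) * PI (I @^-1` B) * PW (W @^-1` C))%E.
  move=> mA mB mC.
  rewrite (_ : _ `&` _ = (X @^-1` A `*` I @^-1` B) `*` (W @^-1` C))//.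
  have mXA := measurable_RV X _ mA; have mIB := measurable_RV I _ mB.
  have mWC := measurable_RV W _ mC.
  rewrite /P/= product_measure1E//; last exact: measurableX.
  by rewrite /= product_measure1E.
have X'E A : measurable A -> P (X' @^-1` A) = PX (X @^-1` A).
  move=> mA; have := box A setT setT mA measurableT measurableT.
  by rewrite !preimage_setT !setIT !probability_setT !mule1.
have I'E A : measurable A -> P (I' @^-1` A) = PI (I @^-1` A).
  move=> mA; have := box setT A setT measurableT mA measurableT.
  by rewrite !preimage_setT setTI setIT !probability_setT mul1e mule1.
have W'E A : measurable A -> P (W' @^-1` A) = PW (W @^-1` A).
  move=> mA; have := box setT setT A measurableT measurableT mA.
  by rewrite !preimage_setT !setTI !probability_setT !mul1e.
exists X', I', W'; split => //.
by apply/mutually_independent3P => A B C mA mB mC; rewrite box// X'E// I'E// W'E.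
Qed.

(** By [update_law] the law of I (W + X)^+ is the same whatever
    the copies, and [independent_triple] supplies one choice of them. *)
Lemma solves_fixpointP {R : realType} (p : R) {dX dI dW}
    {TX : measurableType dX} {TI : measurableType dI} {TW : measurableType dW}
    {PX : probability TX R} {PI : probability TI R} {PW : probability TW R}
    (X : {RV PX >-> R}) (I : {RV PI >-> R}) (W : {RV PW >-> R}) :
  PI [set w | I w = 1] = (1 - p)%:E -> PI [set w | I w = 0] = p%:E ->
  solves_fixpoint X I W <->
  forall A, measurable A -> distribution PW W A =
    lindley_update p (distribution PX X) (distribution PW W) A.
Proof.
move=> I1 I0.
have law d (T : measurableType d) (P : probability T R)
    (X' I' W' : {RV P >-> R}) :
    mutually_independent (tnth [tuple X'; I'; W']) ->
    eq_law X' X -> eq_law I' I -> eq_law W' W -> forall A, measurable A ->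
    distribution P (I' \* (W' \+ X')^\+ : {RV P >-> R}) A =
    lindley_update p (distribution PX X) (distribution PW W) A.
  move=> ind lX lI lW A mA.
  apply: (update_law p P X' I' W' (distribution PX X) (distribution PW W)) => //.
  - by rewrite -I1; exact: lI.
  - by rewrite -I0; exact: lI.
split=> [fix_W A mA|fix_mu d T P X' I' W' ind lX lI lW A mA].
  have [X' [I' [W' [ind lX lI lW]]]] := independent_triple PX PI PW X I W.
  by rewrite -(fix_W _ _ _ X' I' W')// law.
by rewrite law// -fix_mu.
Qed.

(** * The law of the running maximum of a random walk *)

(** Cylinders over the first [k] variables: a pi-system for their past that is
    enough to express that later variables are independent of it. *)
Definition prefix_event {d d'} {T : measurableType d} {T' : measurableType d'}
    {R : realType} {P : probability T R} (xi : nat -> {RV P >-> T'}) (k : nat)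
    (B : nat -> set T') : set T :=
  \bigcap_(j in `I_k) (xi j @^-1` B j).

Lemma measurable_prefix_event {d d'} {T : measurableType d}
    {T' : measurableType d'} {R : realType} {P : probability T R}
    (xi : nat -> {RV P >-> T'}) k B :
  (forall j, measurable (B j)) -> measurable (prefix_event xi k B).
Proof.
by move=> mB; apply: bigcap_measurableType => j _; exact: measurable_RV.
Qed.

Lemma prefix_event_prob {d d'} {T : measurableType d} {T' : measurableType d'}
    {R : realType} {P : probability T R} (xi : nat -> {RV P >-> T'}) k B :
  mutually_independent xi -> (forall j, measurable (B j)) ->
  P (prefix_event xi k B) = (\prod_(0 <= j < k) P (xi j @^-1` B j))%E.
Proof.
move=> ind mB.
have := ind [fset j in iota 0 k]%fset B (fun j _ => mB j).
rewrite (perm_big (iota 0 k)); last first.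
  apply: uniq_perm; rewrite ?fset_uniq ?iota_uniq// => j.
  by rewrite !inE.
rewrite /index_iota subn0 => <-; congr (P _).
by apply/seteqP; split=> w wB j; have := wB j; rewrite /= !inE mem_iota.
Qed.

(** Constraining one more variable gives a longer cylinder and multiplies the
    probability; this is the only form in which mutual independence enters the
    induction below. *)
Lemma prefix_event_next {d d'} {T : measurableType d} {T' : measurableType d'}
    {R : realType} {P : probability T R} (xi : nat -> {RV P >-> T'}) k B C :
  mutually_independent xi -> (forall j, measurable (B j)) -> measurable C ->
  exists B', [/\ forall j, measurable (B' j),
    prefix_event xi k B `&` xi k @^-1` C = prefix_event xi k.+1 B' &
    P (prefix_event xi k.+1 B') = (P (prefix_event xi k B) * P (xi k @^-1` C))%E].
Proof.
move=> ind mB mC.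
pose B' j := if j == k then C else B j.
have mB' j : measurable (B' j) by rewrite /B'; case: ifP.
have B'k : B' k = C by rewrite /B' eqxx.
have B'lt j : (j < k)%N -> B' j = B j by rewrite /B' => /ltn_eqF ->.
exists B'; split => //.
  apply/seteqP; split=> [w [wB wC] j /=|w wB'].
    rewrite ltnS leq_eqVlt => /predU1P[->|jk]; first by rewrite B'k.
    by rewrite B'lt//; exact: wB.
  split=> [j jk|]; last by have := wB' k (ltnSn k); rewrite B'k.
  by rewrite -B'lt//; exact/wB'/ltnW.
rewrite !prefix_event_prob// big_nat_recr//= B'k; congr (_ * _)%E.
by apply: eq_big_nat => j /andP[_ jk]; rewrite B'lt.
Qed.

(** The maximum over the times [k, ..., k + n] of the walk with increments [xi],
    measured from its position at time [k]. It is built from the last increment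
    backwards, so that each step adds an independent earlier increment. *)
Fixpoint reflected_max {d} {T : measurableType d} {R : realType}
    {P : probability T R} (xi : nat -> {RV P >-> R}) (k n : nat) (w : T) : R :=
  if n is m.+1 then lindley (xi k w, reflected_max xi k.+1 m w) else 0.

Lemma measurable_reflected_max {d} {T : measurableType d} {R : realType}
    {P : probability T R} (xi : nat -> {RV P >-> R}) k n :
  measurable_fun setT (reflected_max xi k n).
Proof.
elim: n k => [|n IH] k /=; first exact: measurable_cst.
apply: (measurableT_comp (@measurable_lindley R)).
by apply: measurable_fun_pair; [exact: measurable_funPT|exact: IH].
Qed.

HB.instance Definition _ d (T : measurableType d) (R : realType)
  (P : probability T R) (xi : nat -> {RV P >-> R}) k n :=
  isMeasurableFun.Build _ _ _ _ (reflected_max xi k n)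
    (measurable_reflected_max xi k n).

(** The initial value [x] is kept arbitrary because the bound [k] moves in the
    induction, so that no fixed term of the walk could serve throughout. *)
Lemma reflected_maxE {d} {T : measurableType d} {R : realType}
    {P : probability T R} (S : nat -> {RV P >-> R}) k n x w :
  \big[Num.max/x]_(k <= j < (k + n).+1) S j w =
  Num.max x (S k w + reflected_max (increment S) k n w).
Proof.
elim: n k => [|n IH] k.
  by rewrite addn0 big_ltn// big_geq//= addr0 maxC.
rewrite big_ltn ?ltnS ?leq_addr// addnS -addSn IH/= /lindley/=.
rewrite maxCA; congr (Num.max _ _).
rewrite addr_maxr addr0 maxC; congr (Num.max _ _).
by rewrite addrCA (addrC (S k w)) subrK addrC.
Qed.

Lemma reflected_max_ge0 {d} {T : measurableType d} {R : realType}
    {P : probability T R} (xi : nat -> {RV P >-> R}) k n w :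
  0 <= reflected_max xi k n w.
Proof. by case: n => [|n]//=; rewrite /lindley le_max lexx orbT. Qed.

Section reflected_max_law.
Context d (T : measurableType d) (R : realType) (P : probability T R).
Context (xi : nat -> {RV P >-> R}) (nu : probability R R).
Context (ind : mutually_independent xi).
Context (law_xi : forall k A, measurable A -> P (xi k @^-1` A) = nu A).

Let L n : probability R R :=
  distribution P (reflected_max xi 0 n : {RV P >-> R}).

(* The induction hypothesis says that the reflected maximum over [n] steps is
   independent of the past and has a law that does not depend on its starting
   time. It makes the increment [k] and the later maximum independent of each
   other and of the past. *)
Let step n k B A : (forall j, measurable (B j)) -> measurable A ->
  (forall k B A, (forall j, measurable (B j)) -> measurable A ->
    P (prefix_event xi k B `&` reflected_max xi k n @^-1` A) =
    (P (prefix_event xi k B) * L n A)%E) ->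
  P (prefix_event xi k B `&` reflected_max xi k n.+1 @^-1` A) =
  (P (prefix_event xi k B) * (nu \x L n) (lindley @^-1` A))%E.
Proof.
move=> mB mA IH.
apply: (@joint_law_given _ _ _ _ _ _ _ P nu (L n) (xi k)
  (reflected_max xi k.+1 n : {RV P >-> R})).
- exact: measurable_prefix_event.
- move=> C D mC mD; rewrite setIA.
  have [B' [mB' -> PB']] := prefix_event_next xi k B C ind mB mC.
  by rewrite IH// PB' law_xi// muleA.
- exact: measurable_lindley_preimage.
Qed.

(* With an empty past, the previous step computes the law of the longer maximum
   itself. *)
Let recursion n A : measurable A ->
  (forall k B A, (forall j, measurable (B j)) -> measurable A ->
    P (prefix_event xi k B `&` reflected_max xi k n @^-1` A) =
    (P (prefix_event xi k B) * L n A)%E) ->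
  L n.+1 A = (nu \x L n)%E (lindley @^-1` A).
Proof.
move=> mA IH.
have := step n 0 (fun=> setT) A (fun=> measurableT) mA IH.
have -> : prefix_event xi 0 (fun=> setT) = setT.
  by rewrite -subTset => w _ j.
by rewrite setTI probability_setT mul1e.
Qed.

Let reflected_max_indep n : forall k B A,
  (forall j, measurable (B j)) -> measurable A ->
  P (prefix_event xi k B `&` reflected_max xi k n @^-1` A) =
  (P (prefix_event xi k B) * L n A)%E.
Proof.
elim: n => [|n IH] k B A mB mA; last by rewrite step// recursion.
rewrite [L 0%N A](_ : _ = P (reflected_max xi 0 0 @^-1` A))//.
have [A0|A0] := pselect (A 0).
  have A1 j : reflected_max xi j 0 @^-1` A = setT by rewrite -subTset.
  by rewrite !A1 setIT probability_setT mule1.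
have A0' j : reflected_max xi j 0 @^-1` A = set0 by rewrite -subset0.
by rewrite !A0' setI0 measure0 mule0.
Qed.

(** Lindley's recursion: one more step puts an independent increment in front of
    the walk. *)
Lemma reflected_max_law n A : measurable A ->
  distribution P (reflected_max xi 0 n.+1 : {RV P >-> R}) A =
  (nu \x distribution P (reflected_max xi 0 n : {RV P >-> R}))%E
    (lindley @^-1` A).
Proof. by move=> mA; apply: recursion => //; exact: reflected_max_indep. Qed.

End reflected_max_law.

(** * The maximum at an independent geometric time *)

(** Independence of N from the walk is stated with the sigma-algebra of the
    walk, so the running maximum has to be measurable for that sigma-algebra
    rather than for the ambient one. *)
Lemma sigma_process_running_max {d} {T : measurableType d} {R : realType}
    {P : probability T R} (S : nat -> {RV P >-> R}) n (A : set R) :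
  measurable A ->
  sigma_process S
    ((fun w => \big[Num.max/S 0%N w]_(0 <= k < n.+1) S k w) @^-1` A).
Proof.
move=> mA.
pose G := \bigcup_k g_sigma_algebra_preimage (S k).
have mS k : measurable_fun setT (S k : g_sigma_algebraType G -> R).
  move=> _ B mB; apply: (@sub_sigma_algebra _ setT G).
  by exists k => //; exists B.
suff mM (s : seq nat) : measurable_fun setT
    ((fun w => \big[Num.max/S 0%N w]_(k <- s) S k w) : g_sigma_algebraType G -> R).
  by have := mM (index_iota 0 n.+1) measurableT A mA; rewrite setTI.
elim: s => [|k s IH].
  by under eq_fun do rewrite big_nil; exact: mS.
under eq_fun do rewrite big_cons.
exact: measurable_maxr (mS k) IH.
Qed.

(** On the event N = n the stopped maximum is the running maximum at time n, and
    the two events are independent. *)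
Lemma stopped_max_law {d} {T : measurableType d} {R : realType}
    {P : probability T R} (S : nat -> {RV P >-> R}) (N : {RV P >-> nat}) A :
  (forall w, S 0%N w = 0) -> independent_of_process N S -> measurable A ->
  distribution P (stopped_max S N : {RV P >-> R}) A =
  (\sum_(n <oo) P [set w | N w = n] *
    distribution P (reflected_max (increment S) 0 n : {RV P >-> R}) A)%E.
Proof.
move=> S0 indN mA.
have maxE n w : \big[Num.max/S 0%N w]_(0 <= k < n.+1) S k w =
    reflected_max (increment S) 0 n w.
  have := reflected_maxE S 0 n (S 0%N w) w; rewrite add0n => ->.
  by rewrite S0 add0r; apply/max_idPr; exact: reflected_max_ge0.
pose F n := N @^-1` [set n] `&` reflected_max (increment S) 0 n @^-1` A.
have mN n : measurable (N @^-1` [set n]) by exact: measurable_RV.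
have mF n : measurable (F n).
  apply: measurableI => //.
  exact: (measurable_RV (reflected_max (increment S) 0 n : {RV P >-> R})).
have -> : distribution P (stopped_max S N : {RV P >-> R}) A = P (\bigcup_n F n).
  congr (P _); apply/seteqP; split=> [w|w [n _ [/= Nw]]].
    by rewrite /= /stopped_max maxE => Aw; exists (N w).
  by rewrite /= /stopped_max maxE Nw.
rewrite measure_semi_bigcup//; last 2 first.
- by move=> i j _ _ [w [[/= <- _] [/= <- _]]].
- exact: bigcup_measurable.
apply: eq_eseriesr => n _; apply: indN.
  by exists [set n] => //; rewrite setTI.
rewrite (_ : _ @^-1` A =
    (fun w => \big[Num.max/S 0%N w]_(0 <= k < n.+1) S k w) @^-1` A).
  exact: sigma_process_running_max.
by apply/seteqP; split=> w; rewrite /= maxE.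
Qed.

(** Monotone convergence: integration of the sections over the first factor
    commutes with a nonnegative series. *)
Lemma product_measure_mixture {d1 d2} {T1 : measurableType d1}
    {T2 : measurableType d2} {R : realType} (nu : probability T1 R)
    (pi : probability T2 R) (L : nat -> probability T2 R) (c : nat -> R) :
  (forall n, 0 <= c n) ->
  (forall A, measurable A -> pi A = \sum_(n <oo) (c n)%:E * L n A)%E ->
  forall D, measurable D ->
    ((nu \x pi) D = \sum_(n <oo) (c n)%:E * (nu \x L n) D)%E.
Proof.
move=> c0 mix D mD.
have cL0 n A : (0 <= (c n)%:E * L n A)%E by rewrite mule_ge0// lee_fin.
transitivity (\int[nu]_x \sum_(n <oo) (c n)%:E * L n (xsection D x))%E.
  by apply: eq_integral => x _; rewrite /= mix//; exact: measurable_xsection.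
rewrite integral_nneseries//; last first.
  by move=> n; apply: measurable_funeM; exact: measurable_fun_xsection.
apply: eq_eseriesr => n _; rewrite ge0_integralZl//.
  exact: measurable_fun_xsection.
by rewrite lee_fin.
Qed.

(** In the mixture of the laws of the running maxima, the term of index 0 is the
    atom [p * delta_0] because S_0 = 0; shifting the index in the other terms
    brings out the factor [1 - p] of the geometric weights and, through
    Lindley's recursion, the product with the law of X. *)
Lemma stopped_max_fixpoint {R : realType} (p : R) {d dX}
    {T : measurableType d} {TX : measurableType dX} {P : probability T R}
    {PX : probability TX R} (X : {RV PX >-> R}) (S : nat -> {RV P >-> R})
    (N : {RV P >-> nat}) (pi := distribution P (stopped_max S N : {RV P >-> R})) :
  0 < p < 1 -> random_walk S X -> independent_of_process N S ->
  (forall n, P [set w | N w = n] = ((1 - p) ^+ n * p)%:E) ->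
  forall A, measurable A -> pi A = lindley_update p (distribution PX X) pi A.
Proof.
move=> /andP[p0 p1] [S0 indS lawS] indN lawN.
pose L n := distribution P (reflected_max (increment S) 0 n : {RV P >-> R}).
have c0 n : 0 <= (1 - p) ^+ n * p.
  by rewrite mulr_ge0 ?exprn_ge0 ?subr_ge0// ltW.
have mix A : measurable A ->
    pi A = (\sum_(n <oo) ((1 - p) ^+ n * p)%:E * L n A)%E.
  move=> mA; rewrite /pi stopped_max_law//.
  by apply: eq_eseriesr => n _; rewrite lawN.
have cL0 n A : (0 <= ((1 - p) ^+ n * p)%:E * L n A)%E.
  by rewrite mule_ge0// lee_fin.
move=> A mA; rewrite mix// nneseries_recl//; congr (_ + _)%E.
  rewrite expr0 mul1r; congr (_ * _)%E.
  rewrite /L/= /distribution/pushforward/= diracE.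
  have [A0|A0] := pselect (A 0).
    rewrite mem_set// (_ : _ @^-1` A = setT) ?probability_setT//.
    by rewrite -subTset.
  rewrite memNset// (_ : _ @^-1` A = set0) ?measure0//.
  by rewrite -subset0.
rewrite -nneseries_addn//.
rewrite (product_measure_mixture _ _ L (fun n => (1 - p) ^+ n * p))//; last first.
  exact: measurable_lindley_preimage.
rewrite -nneseriesZl; last first.
  by move=> n _; rewrite mule_ge0// lee_fin.
apply: eq_eseriesr => n _.
rewrite addn1 /L (@reflected_max_law _ _ _ _ _ (distribution PX X))//.
by rewrite muleA -EFinM mulrA -exprS.
Qed.

Theorem proposition2 (R : realType) (p : R) (hp : 0 < p < 1)
  (dI : measure_display) (TI : measurableType dI) (PI : probability TI R)
  (I : {RV PI >-> R})
  (hI1 : PI [set w | I w = 1] = (1 - p)%:E)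
  (hI0 : PI [set w | I w = 0] = p%:E)
  (dX : measure_display) (TX : measurableType dX) (PX : probability TX R)
  (X : {RV PX >-> R})
  (d : measure_display) (T : measurableType d) (P : probability T R)
  (S : nat -> {RV P >-> R}) (N : {RV P >-> nat})
  (hS : random_walk S X)
  (hSN : independent_of_process N S)
  (hN : forall n : nat, P [set w | N w = n] = ((1 - p) ^+ n * p)%:E)
  (dW : measure_display) (TW : measurableType dW) (PW : probability TW R)
  (W : {RV PW >-> R}) :
  solves_fixpoint X I W <-> eq_law W (stopped_max S N : {RV P >-> R}).
Proof.
have fix_max := stopped_max_fixpoint p X S N hp hS hSN hN.
split=> [/(solves_fixpointP p X I W hI1 hI0) fix_W A mA|lawW].
  exact: (update_fixpoint_unique p (distribution PX X) (distribution PW W)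
    (distribution P (stopped_max S N : {RV P >-> R}))).
apply/(solves_fixpointP p X I W hI1 hI0) => A mA.
rewrite lawW// fix_max// /lindley_update; congr (_ + _ * _)%E.
apply: eq_integral => x _ /=; rewrite -lawW//.
by apply: measurable_xsection; exact: measurable_lindley_preimage.
Qed.
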